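(* Let $X$ be a real or complex Banach space such that $X=M\oplus_{\ell^\infty}N$ for closed subspaces $M$ and $N$ of $X$. Let $x\in S(X)$ be such that $x=m+n$, where $m\in M$, $n\in N$. Then the following statements are true. (a) Let $\|n\|<1$. Then $S_x$ is weakly compact in $X^*$ if and only if $S^{M^*}_m$ is weakly compact in $M^*$. (b) Let $\|n\|=\|m\|=1$. Then $S_x$ is weakly compact in $X^*$ if and only if $S^{M^*}_m$ is weakly compact in $M^*$ and $S^{N^*}_n$ is weakly compact in $N^*$.
   Context: $X=M\oplus_{\ell^\infty}N$ means that $X$ is the algebraic direct sum of its closed subspaces $M$ and $N$ and $\|m+n\|=\max\{\|m\|,\|n\|\}$ for all $m\in M$, $n\in N$. $S(E)$ denotes the unit sphere of a Banach space $E$. For $x\in S(X)$, $S_x=\{x^*\in S(X^* ):x^*(x)=1\}$; for a closed subspace $Y\subseteq X$ and $y\in S(Y)$, $S^{Y^*}_y=\{y^*\in S(Y^* ):y^*(y)=1\}$. Weakly compact in $E^*$ means compact in the weak topology $\sigma(E^*,E^{**})$. *)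

(* Defs.v *)
From HB Require Import structures.
From mathcomp Require Import all_boot all_order all_algebra.
From mathcomp Require Import complex.
From mathcomp Require Import all_classical all_reals.
From mathcomp Require Import topology normedtype.
Set Implicit Arguments.
Unset Strict Implicit.
Unset Printing Implicit Defensive.
Import Order.TTheory GRing.Theory Num.Theory.
Import numFieldNormedType.Exports.
Local Open Scope classical_set_scope.
Local Open Scope ring_scope.

Variant scalar_kind := RealScalars | ComplexScalars.

Definition scalars (R : realType) (k : scalar_kind) : numFieldType :=
  match k with
  | RealScalars => R : numFieldType
  | ComplexScalars => R[i] : numFieldType
  end.

(* In MathComp-Analysis the norm of a normed module over K takes its values in
   K, so for complex scalars it lies on the copy of R inside R[i]. The next two
   functions move such values between R, where suprema live, and K. *)
Definition scalar_of_real {R : realType} {k : scalar_kind} :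
    R -> scalars R k :=
  match k return R -> scalars R k with
  | RealScalars => fun a => a
  | ComplexScalars => fun a => real_complex R a
  end.

Definition real_of_scalar {R : realType} {k : scalar_kind} :
    scalars R k -> R :=
  match k return scalars R k -> R with
  | RealScalars => fun z => z
  | ComplexScalars => fun z => complex.Re z
  end.

Section scalars.
Context {R : realType} {k : scalar_kind}.
Implicit Types (a b : R) (z : scalars R k).

Lemma ler_scalar_of_real a b :
  ((scalar_of_real a : scalars R k) <= scalar_of_real b) = (a <= b).
Proof. by case: k => //=; rewrite lecE /= eqxx. Qed.

Lemma scalar_of_realK z : 0 <= z -> scalar_of_real (real_of_scalar z) = z.
Proof.
case: k z => //= -[x y]; rewrite lecE /= => /andP[/eqP -> _].
by [].
Qed.

End scalars.

Section submodule.
Context {K : numFieldType} {X : normedModType K} (M : submodClosed X).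

Record submodule := Submodule { submodule_val : X; _ : submodule_val \in M }.

HB.instance Definition _ := [isSub for submodule_val].
HB.instance Definition _ := [Choice of submodule by <:].
HB.instance Definition _ := [SubChoice_isSubLmodule of submodule by <:].

Definition submodule_norm (u : submodule) : K := `|val u|.

Let ler_submodule_normD u v :
  submodule_norm (u + v) <= submodule_norm u + submodule_norm v.
Proof. by rewrite /submodule_norm raddfD ler_normD. Qed.

Let submodule_normZ (a : K) u :
  submodule_norm (a *: u) = `|a| * submodule_norm u.
Proof. by rewrite /submodule_norm linearZ normrZ. Qed.

Let submodule_norm0_eq0 u : submodule_norm u = 0 -> u = 0.
Proof. by move/normr0_eq0 => u0; apply: val_inj; rewrite u0 raddf0. Qed.

HB.instance Definition _ := @Lmodule_isNormed.Build K submodule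
  submodule_norm ler_submodule_normD submodule_normZ submodule_norm0_eq0.

End submodule.

Section dual.
Context {R : realType} {k : scalar_kind}.
Local Notation K := (scalars R k).
Variable X : normedModType K.

Definition continuous_linear : {pred X -> K^o} :=
  fun f => `[< linear f /\ continuous f >].

Lemma continuous_linear_submod_closed : submod_closed continuous_linear.
Proof.
split.
  apply/asboolP; split=> [a u v|x]; first by rewrite /= scaler0 addr0.
  exact: cst_continuous.
move=> a f g /asboolP[lf cf] /asboolP[lg cg]; apply/asboolP; split.
  move=> b u v; rewrite /= !fctE lf lg.
  by rewrite !scalerDr !scalerA addrACA mulrC.
move=> x; apply: continuousD; last exact: cg.
by apply: continuousZ; [exact: cst_continuous|exact: cf].
Qed.

HB.instance Definition _ := GRing.isSubmodClosed.Build K (X -> K^o)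
  continuous_linear continuous_linear_submod_closed.

Record dual := Dual { dual_fun :> X -> K^o; _ : dual_fun \in continuous_linear }.

HB.instance Definition _ := [isSub for dual_fun].
HB.instance Definition _ := [Choice of dual by <:].
HB.instance Definition _ := [SubChoice_isSubLmodule of dual by <:].

Definition dual_norm (f : dual) : K :=
  scalar_of_real
    (sup [set real_of_scalar `|f x : K| | x in [set x : X | `|x| <= 1]]).

Lemma dual_linear (f : dual) : linear f.
Proof. by case: f => f /= /asboolP[]. Qed.

HB.instance Definition _ (f : dual) :=
  GRing.isLinear.Build K X K^o *:%R f (dual_linear f).

Lemma dual_continuous (f : dual) : continuous f.
Proof. by case: f => f /= /asboolP[]. Qed.

Lemma dual_bounded (f : dual) :
  exists2 r : K, 0 <= r & forall x, `|f x : K| <= r * `|x|.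
Proof.
have /linear_boundedP/pinfty_ex_gt0[r r0 fr] : bounded_near f (nbhs 0).
  by apply/linear_bounded_continuous; exact: dual_continuous.
by exists r; [exact: ltW|exact: fr].
Qed.

Let ball_image (f : dual) : set R :=
  [set real_of_scalar `|f x : K| | x in [set x : X | `|x| <= 1]].

Let ball_image_neq0 f : ball_image f !=set0.
Proof. by exists (real_of_scalar `|f 0 : K|), 0; rewrite //= normr0 ler01. Qed.

Lemma dual_norm_ge (f : dual) x : `|x| <= 1 -> `|f x : K| <= dual_norm f.
Proof.
move=> x1; rewrite -[leLHS]scalar_of_realK// ler_scalar_of_real.
have [r r0 fr] := dual_bounded f.
apply: ub_le_sup; last by exists x.
exists (real_of_scalar r) => _ [y /= y1 <-].
rewrite -(@ler_scalar_of_real _ k) !scalar_of_realK//.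
by rewrite (le_trans (fr y))// -[leRHS]mulr1 ler_wpM2l.
Qed.

Lemma dual_norm_le (f : dual) (c : K) :
  (forall x, `|x| <= 1 -> `|f x : K| <= c) -> dual_norm f <= c.
Proof.
move=> fc; have c0 : 0 <= c.
  by apply: le_trans (fc 0 _); rewrite ?normr_ge0// normr0 ler01.
rewrite -[leRHS]scalar_of_realK// ler_scalar_of_real.
apply: ge_sup; first exact: ball_image_neq0.
move=> _ [y /= y1 <-].
by rewrite -(@ler_scalar_of_real _ k) !scalar_of_realK// fc.
Qed.

Let ler_dual_normD f g : dual_norm (f + g) <= dual_norm f + dual_norm g.
Proof.
apply: dual_norm_le => x x1.
by rewrite (le_trans (ler_normD _ _))// lerD// dual_norm_ge.
Qed.

Let dual_norm_leZ (a : K) f : dual_norm (a *: f) <= `|a| * dual_norm f.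
Proof.
apply: dual_norm_le => x x1.
by rewrite [X in `|X|](_ : _ = a * f x)// normrM ler_wpM2l// dual_norm_ge.
Qed.

Let dual_norm0_eq0 f : dual_norm f = 0 -> f = 0.
Proof.
move=> f0; apply/val_inj/funext => x; rewrite /= -[RHS]/(0 : K).
have [->|x0] := eqVneq x 0; first exact: linear0.
have nx1 : `| `|x|^-1 *: x | <= 1.
  by rewrite normrZ normfV normr_id mulVf ?normr_eq0.
have := dual_norm_ge f nx1; rewrite f0 normr_le0 linearZ /= scaler_eq0.
by rewrite invr_eq0 normr_eq0 (negPf x0) => /eqP.
Qed.

Let dual_normZ (a : K) f : dual_norm (a *: f) = `|a| * dual_norm f.
Proof.
apply/eqP; rewrite eq_le dual_norm_leZ /=.
have [->|a0] := eqVneq a 0.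
  rewrite normr0 mul0r (le_trans _ (dual_norm_ge (0 *: f) (x := 0) _))//.
  by rewrite normr0 ler01.
rewrite -ler_pdivlMl ?normr_gt0// -normfV.
by rewrite -[in leLHS](scalerK a0 f) dual_norm_leZ.
Qed.

HB.instance Definition _ := @Lmodule_isNormed.Build K dual
  dual_norm ler_dual_normD dual_normZ dual_norm0_eq0.

End dual.

(* The coarsest topology on E making every element of its dual continuous; for
   E = dual X it is induced by the bidual, so it is not the weak-star topology. *)
Definition weak_topology {R : realType} {k : scalar_kind}
    (E : normedModType (scalars R k)) : topologicalType :=
  sup_topology (fun f : dual E => Topological.on (initial_topology f)).

Definition weakly_compact {R : realType} {k : scalar_kind}
    (E : normedModType (scalars R k)) (A : set E) : Prop :=
  compact (A : set (weak_topology E)).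

Definition sphere {K : numFieldType} (E : normedModType K) : set E :=
  [set x | `|x| = 1].

Definition support_set {R : realType} {k : scalar_kind}
    (E : normedModType (scalars R k)) (x : E) : set (dual E) :=
  [set f : dual E | sphere f /\ f x = 1].

(* When K is R[i] its order is only partial, but norms are nonnegative, hence
   comparable, so Num.max is a genuine maximum here. *)
Definition linf_direct_sum {K : numFieldType} {X : normedModType K}
    (M N : submodClosed X) : Prop :=
  [/\ closed [set` M], closed [set` N],
      forall x, exists m n, [/\ m \in M, n \in N & x = m + n],
      forall x, x \in M -> x \in N -> x = 0
    & forall m n, m \in M -> n \in N -> `|m + n| = Num.max `|m| `|n| ].

(* Main.v *)
(* For a norm-one x = m + n, a functional f in S_x has f(m), f(n) >= 0 with
   f(m) + f(n) = 1, and rotating arguments in the unit balls of M and N gives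
   |f| <= f(m) on the ball of M and |f| <= f(n) on that of N. So f splits as the
   convex combination, with weights f(m) and f(n), of functionals in S_m and S_n
   extended by zero along the decomposition. If |n| < 1, then |f(n)| <= f(n) |n|
   forces f(n) = 0. Restriction and extension by zero are nonexpansive linear
   maps between the duals, hence weakly continuous. Thus S_x is a continuous
   image of the given compact sets; conversely S_m is the image under
   restriction of the weakly closed part of S_x vanishing on N. *)
From HB Require Import structures.
Require Import Defs.
From mathcomp Require Import all_boot all_order all_algebra.
From mathcomp Require Import complex.
From mathcomp Require Import all_classical all_reals.
From mathcomp Require Import topology normedtype.
Import Order.TTheory GRing.Theory Num.Theory.
Import numFieldNormedType.Exports.
Local Open Scope classical_set_scope.
Local Open Scope ring_scope.

(** * Weak continuity of functionals and of adjoints of contractions; scalar facts *)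

Section weak_topology.
Context {R : realType} {k : scalar_kind}.
Local Notation K := (scalars R k).

Lemma weak_eval_continuous {E : normedModType K} (f : dual E) :
  continuous (f : weak_topology E -> K^o).
Proof.
move=> x; have /cvg_sup/(_ f) xf :
  nbhs (x : weak_topology E) --> (x : weak_topology E) by [].
by apply: cvg_trans (@initial_continuous _ _ f x); apply: cvg_app.
Qed.

Lemma weak_continuous {T : topologicalType} {E : normedModType K}
    (g : T -> weak_topology E) :
  (forall f : dual E, continuous (fun t => f (g t) : K^o)) -> continuous g.
Proof.
move=> fg t; apply/cvg_sup => f A /= [_ [[B oB <-] Bt] BA].
have tB : nbhs t (g @^-1` (f @^-1` B)).
  by apply: (fg f t); exact: open_nbhs_nbhs.
by apply: filterS tB => s; exact: BA.
Qed.

Lemma bounded_continuous {E F : normedModType K} (T : {linear E -> F}) (r : K) :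
  0 <= r -> (forall x, `|T x| <= r * `|x|) -> continuous T.
Proof.
move=> r0 Tr; apply: bounded_linear_continuous; apply/linear_boundedP => /=.
have := nbhs_pinfty_ge (ger0_real r0).
by apply: filterS => s rs x; rewrite (le_trans (Tr x))// ler_wpM2r.
Qed.

Lemma norm1_bounded_continuous {E F : normedModType K} (T : {linear E -> F}) :
  (forall x, `|T x| <= `|x|) -> continuous T.
Proof.
by move=> T1; apply: (@bounded_continuous _ _ _ 1) => // x; rewrite mul1r.
Qed.

Section adjoint.
Context {E F : normedModType K} {T : {linear E -> F}}.
Hypothesis T1 : forall x, `|T x| <= `|x|.

Lemma adjoint_subproof (f : dual F) :
  (f \o T : E -> K^o) \in @continuous_linear R k E.
Proof.
apply/asboolP; split=> [a u v|]; first by rewrite /= !linearP.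
move=> x; apply: continuous_comp; first exact: norm1_bounded_continuous.
exact: dual_continuous.
Qed.

(** The adjoint of a contraction is again a contraction by [adjoint_norm1], so it can itself be
    transposed: this second adjoint supplies the functionals needed for weak continuity between
    duals. *)
Definition adjoint (f : dual F) : dual E := Dual (adjoint_subproof f).

Lemma adjoint_is_linear : linear adjoint.
Proof. by move=> a f g; exact/val_inj/funext. Qed.

HB.instance Definition _ :=
  GRing.isLinear.Build K (dual F) (dual E) *:%R adjoint adjoint_is_linear.

Lemma adjoint_norm1 f : `|adjoint f| <= `|f|.
Proof.
apply: dual_norm_le => x x1; exact: (dual_norm_ge f (le_trans (T1 x) x1)).
Qed.

End adjoint.
Arguments adjoint {E F T} T1 f.

(** Testing [T] against a functional [f] gives [adjoint T1 f], a functional on [E], which is weakly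
    continuous by construction. *)
Lemma norm1_weak_continuous {E F : normedModType K} {T : {linear E -> F}} :
  (forall x, `|T x| <= `|x|) ->
  continuous (T : weak_topology E -> weak_topology F).
Proof.
move=> T1; apply: weak_continuous => f.
exact: (weak_eval_continuous (adjoint T1 f)).
Qed.

Lemma dual_norm_ler {E : normedModType K} (f : dual E) x :
  `|f x : K| <= `|f| * `|x|.
Proof.
have [->|x0] := eqVneq x 0; first by rewrite linear0 !normr0 mulr0.
have nx1 : `| `|x|^-1 *: x | <= 1.
  by rewrite normrZ normfV normr_id mulVf ?normr_eq0.
have := dual_norm_ge f nx1; rewrite linearZ /= normrM normfV normr_id.
by rewrite ler_pdivrMl ?normr_gt0// mulrC.
Qed.

Lemma bidual_eval_linear {E : normedModType K} (x : E) :
  linear ((fun f => f x) : dual E -> K^o).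
Proof. by []. Qed.

(** Evaluation at [x] is the canonical image of [x] in the bidual, bounded by the norm of [x]. It
    makes zero sets of evaluations weakly closed in the dual. *)
Lemma weak_bidual_eval_continuous {E : normedModType K} (x : E) :
  continuous ((fun f => f x) : weak_topology (dual E) -> K^o).
Proof.
pose ev : {linear dual E -> K^o} :=
  HB.pack ((fun f => f x) : dual E -> K^o)
    (GRing.isLinear.Build K (dual E) K^o *:%R _ (bidual_eval_linear x)).
have ev_cont : (ev : dual E -> K^o) \in @continuous_linear R k (dual E).
  apply/asboolP; split; first exact: linearP.
  apply: (@bounded_continuous _ _ _ `|x|) => // f.
  by rewrite mulrC; exact: dual_norm_ler.
exact: (weak_eval_continuous (Dual ev_cont)).
Qed.

(** The value 1 at the unit vector [x] already forces norm at least 1, so only a pointwise upper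
    bound remains to be checked and no supremum is handled afterwards. *)
Lemma support_setP {E : normedModType K} (x : E) (f : dual E) : `|x| = 1 ->
  support_set x f <-> f x = 1 /\ (forall y, `|f y : K| <= `|y|).
Proof.
move=> x1; split=> [[f1 fx]|[fx f1]]; split=> //.
  by move=> y; rewrite (le_trans (dual_norm_ler f y))// f1 mul1r.
apply/eqP; rewrite eq_le; apply/andP; split.
  by apply: dual_norm_le => y y1; exact: le_trans (f1 y) y1.
have := dual_norm_ler f x; rewrite x1 mulr1 fx.
by rewrite normr1.
Qed.

(** Equality holds in the triangle inequality, so over the complex numbers [a] and [b] lie on one
    ray; their sum being 1, it is the positive real axis. *)
Lemma scalar_ge0_norm_add (a b : K) : a + b = 1 -> `|a| + `|b| <= 1 -> 0 <= a.
Proof.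
move: a b; rewrite /scalars; case: k => a b ab1 nab.
  have : 1 - b <= a by rewrite -ab1 addrK.
  apply: le_trans; rewrite subr_ge0 (le_trans _ nab)//.
  by rewrite (le_trans (ler_norm b))// lerDr.
have : `|a + b| = `|a| + `|b|.
  by apply/eqP; rewrite eq_le ler_normD ab1 normr1.
move/(@normCDeq R[i]) => [t _ [ta tb]].
have t1 : t = 1.
  have nab1 : `|a| + `|b| = 1.
    by apply/eqP; rewrite eq_le nab -(@normr1 R[i]) -ab1 ler_normD.
  by rewrite -ab1 ta tb -mulrDl nab1 mul1r.
by rewrite ta t1 mulr1.
Qed.

Lemma scalar_of_real_continuous : continuous (@scalar_of_real R k : R -> K).
Proof.
have normE a : `|scalar_of_real a : K| = scalar_of_real `|a|.
  by case: k => //=; rewrite normc_def /= expr0n addr0 sqrtr_sqr.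
have sub a b :
    (scalar_of_real (a - b) : K) = scalar_of_real a - scalar_of_real b.
  by case: k => //=; rewrite rmorphB.
move=> a; apply/cvgrPdist_le => e e0.
have re0 : 0 < real_of_scalar e.
  by case: k e e0 => //= -[u v]; rewrite ltcE => /andP[].
near=> b; rewrite -sub normE -[leRHS](scalar_of_realK (ltW e0)).
rewrite ler_scalar_of_real; near: b.
by apply: (@cvgr_dist_le _ R^o _ (nbhs a) _ id a); first exact: cvg_id.
Unshelve. all: by end_near. Qed.

Lemma weakly_compact_image {E F : normedModType K} {T : {linear E -> F}}
    (A : set E) : (forall x, `|T x| <= `|x|) ->
  weakly_compact A -> weakly_compact (T @` A).
Proof.
move=> T1; apply: (@continuous_compact (weak_topology E) (weak_topology F) T).
exact/continuous_subspaceT/norm1_weak_continuous.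
Qed.

End weak_topology.
Arguments adjoint {R k E F T} T1 f.

Lemma scalar_rotation {K : numFieldType} (z : K) :
  exists2 c : K, `|c| <= 1 & c * z = `|z|.
Proof.
have [->|z0] := eqVneq z 0; first by exists 0; rewrite ?normr0 ?mul0r.
by exists (`|z| / z); rewrite ?normf_div ?normr_id ?divff ?normr_eq0 ?divfK.
Qed.

(** * The contractive projection onto a summand *)

Section linf_direct_sum.
Context {R : realType} {k : scalar_kind}.
Local Notation K := (scalars R k).
Context {X : normedModType K} {M N : submodClosed X}.
Implicit Types (u : submodule M) (v : submodule N).

Lemma linf_direct_sumC : linf_direct_sum M N -> linf_direct_sum N M.
Proof.
move=> [cM cN sMN iMN nMN]; split=> // [x|x xN xM|m n mN nM].
- by have [m [n [mM nN ->]]] := sMN x; exists n, m; rewrite addrC.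
- exact: iMN.
- by rewrite addrC nMN// comparable_maxC// real_comparable ?normr_real.
Qed.

Context (h : linf_direct_sum M N).

Lemma linf_norm_le u v (c : K) :
  `|u| <= c -> `|v| <= c -> `|val u + val v| <= c.
Proof.
case: h => _ _ _ _ ->; [|exact: valP..].
by move=> uc vc; rewrite /Num.max; case: ifP.
Qed.

Lemma linf_norm_ge u v : `|u| <= `|val u + val v|.
Proof.
case: h => _ _ _ _ ->; [|exact: valP..].
rewrite comparable_le_max ?lexx//.
by rewrite real_comparable ?normr_real.
Qed.

Lemma linf_split x : exists u, exists v, x = val u + val v.
Proof.
case: h => _ _ /(_ x)[m [n [mM nN ->]]] _ _.
by exists (Submodule mM), (Submodule nN).
Qed.

(** The projection onto [M] along [N]. The choice is harmless, since components are unique because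
    [M] and [N] meet only in 0. *)
Definition linf_fst x : submodule M := projT1 (cid (linf_split x)).

Lemma linf_fstE u v : linf_fst (val u + val v) = u.
Proof.
rewrite /linf_fst; case: cid => /= u' [v' e].
case: h => _ _ _ iMN _; apply/val_inj/eqP; rewrite eq_sym -subr_eq0; apply/eqP.
have e' : val u - val u' = val v' - val v.
  by rewrite -[val u](addrK (val v)) e addrAC [X in X - _]addrC addKr.
apply: iMN; first by rewrite -raddfB; exact: valP.
by rewrite e' -raddfB; exact: valP.
Qed.

Lemma linf_fst_linear : linear linf_fst.
Proof.
move=> a x y; have [u [v ->]] := linf_split x.
have [u' [v' ->]] := linf_split y.
have -> : a *: (val u + val v) + (val u' + val v') =
    val (a *: u + u') + val (a *: v + v').
  by rewrite !linearP scalerDr addrACA.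
by rewrite !linf_fstE.
Qed.

HB.instance Definition _ :=
  GRing.isLinear.Build K X (submodule M) *:%R linf_fst linf_fst_linear.

Lemma linf_fst_val u : linf_fst (val u) = u.
Proof. by rewrite -[RHS](linf_fstE u 0) linear0 addr0. Qed.

Lemma linf_fst_compl v : linf_fst (val v) = 0.
Proof. by rewrite -[RHS](linf_fstE 0 v) linear0 add0r. Qed.

Lemma linf_fst_norm1 x : `|linf_fst x| <= `|x|.
Proof. by have [u [v ->]] := linf_split x; rewrite linf_fstE linf_norm_ge. Qed.

End linf_direct_sum.

(** * Restriction and extension of functionals; compactness passes from S_x to S_m *)

Section support.
Context {R : realType} {k : scalar_kind}.
Local Notation K := (scalars R k).

Section restriction.
Context {X : normedModType K} (M : submodClosed X).

Lemma submodule_val_norm1 (u : submodule M) : `|val u| <= `|u|.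
Proof. by []. Qed.

Definition dual_restrict : dual X -> dual (submodule M) :=
  adjoint submodule_val_norm1.

Lemma dual_restrictE f u : dual_restrict f u = f (val u). Proof. by []. Qed.

End restriction.

Section linf.
Context {X : normedModType K} {M N : submodClosed X}.
Context (h : linf_direct_sum M N).
Implicit Types (u : submodule M) (v : submodule N).

(** Composition with the projection onto [M], that is, extension by zero on [N]. *)
Definition dual_extend : dual (submodule M) -> dual X :=
  adjoint (linf_fst_norm1 h).

Lemma dual_extendE f u v : dual_extend f (val u + val v) = f u.
Proof. by rewrite /= linf_fstE. Qed.

Lemma dual_extendK : cancel dual_extend (dual_restrict M).
Proof.
by move=> f; apply/val_inj/funext => u; rewrite /= linf_fst_val.
Qed.

Context {x : X} {m : submodule M} {n : submodule N}.
Hypotheses (x1 : `|x| = 1) (xE : x = val m + val n).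

Lemma support_extend {f} : `|m| = 1 ->
  support_set m f -> support_set x (dual_extend f).
Proof.
move=> m1 /(support_setP _ _ m1)[fm f1]; apply/support_setP => //.
split=> [|y]; first by rewrite xE dual_extendE.
by rewrite (le_trans (f1 _))//= linf_fst_norm1.
Qed.

Lemma support_fst_compact : `|m| = 1 ->
  weakly_compact (support_set x) -> weakly_compact (support_set m).
Proof.
move=> m1 cx.
(* The annihilator of [N], weakly closed as an intersection of zero sets of evaluations. *)
pose N0 : set (weak_topology (dual X)) :=
  \bigcap_(v in [set: submodule N])
    [set f : dual X | (f (val v) : K^o) = 0].
have clN0 : closed N0.
  apply: closed_bigI => v _.
  apply: (@preimage_closed _ _ (fun f : weak_topology (dual X) =>
    (f : dual X) (val v) : K^o) [set z | z = 0]) => //.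
  - by move=> f _; exact: (weak_bidual_eval_continuous (val v)).
  - apply/accessible_closed_set1/hausdorff_accessible.
    exact: (@norm_hausdorff K K^o).
have -> : support_set m = dual_restrict M @` (support_set x `&` N0).
  apply/seteqP; split=> [f mf|_ [f [xf f0] <-]].
    exists (dual_extend f); last exact: dual_extendK.
    split; first exact: support_extend.
    by move=> v _; rewrite /= linf_fst_compl linear0.
  (* For [f] vanishing on [N], f(m) = f(x) = 1, so the restriction still attains its norm at [m]. *)
  move: xf => /(support_setP _ _ x1)[fx f1].
  apply/support_setP => //; split=> [|u]; last exact: f1.
  by rewrite dual_restrictE -fx xE linearD /= (f0 n I) addr0.
apply: (weakly_compact_image _ (adjoint_norm1 (submodule_val_norm1 M))).
exact: (compact_closedI cx clN0).
Qed.

(** Scalars [c], [d] of modulus at most 1 turn both values into their moduli. The sum is then the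
    value of [f] at [c *: u] plus [d *: v], a vector in the unit ball because the norm is a
    maximum. *)
Lemma support_norm_add {f u v} : support_set x f ->
  `|u| <= 1 -> `|v| <= 1 -> `|f (val u) : K| + `|f (val v) : K| <= 1.
Proof.
move=> /(support_setP _ _ x1)[_ f1] u1 v1.
have [c c1 cu] := scalar_rotation (f (val u) : K).
have [d d1 dv] := scalar_rotation (f (val v) : K).
have -> : `|f (val u) : K| + `|f (val v) : K| =
    f (val (c *: u) + val (d *: v)) :> K.
  by rewrite linearD /= !linearZ /= -cu -dv.
apply: (@le_trans _ _ `|f (val (c *: u) + val (d *: v)) : K|).
  apply: real_ler_norm; rewrite linearD /= !linearZ /=.
  by rewrite [_ *: _]cu [_ *: _]dv rpredD ?normr_real.
apply: le_trans (f1 _) _.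
by apply: (linf_norm_le h); rewrite normrZ mulr_ile1.
Qed.

(** The previous bound at [m] and [n] meets f(m) + f(n) = 1, the equality case of the triangle
    inequality. *)
Lemma support_fst_ge0 {f} :
  support_set x f -> `|n| <= 1 -> 0 <= (f (val m) : K).
Proof.
move=> xf n1; apply: (@scalar_ge0_norm_add _ _ _ (f (val n))).
  by have /(support_setP _ _ x1)[<- _] := xf; rewrite xE linearD.
by apply: support_norm_add => //; rewrite -x1 xE (linf_norm_ge h).
Qed.

End linf.

Lemma linf_snd_norm_le {X : normedModType K} {M N : submodClosed X}
    (h : linf_direct_sum M N) {m : submodule M} {n : submodule N} :
  `|n| <= `|val m + val n|.
Proof. by rewrite addrC (linf_norm_ge (linf_direct_sumC h)). Qed.

(** * Splitting a support functional into its two normalized components *)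

Section linf_support.
Context {X : normedModType K} {M N : submodClosed X}.
Context (h : linf_direct_sum M N).
Context {x : X} {m : submodule M} {n : submodule N}.
Hypotheses (x1 : `|x| = 1) (xE : x = val m + val n).

(** On the unit ball of [M], [support_norm_add] with second vector [n] bounds the modulus of f(w)
    plus f(n) by 1 = f(m) + f(n); cancelling f(n) and rescaling gives the bound everywhere. *)
Lemma support_fst_norm {f} (u : submodule M) : support_set x f ->
  `|f (val u) : K| <= (f (val m) : K) * `|u|.
Proof.
move=> xf; have n1 : `|n| <= 1 by rewrite -x1 xE (linf_snd_norm_le h).
have m1 : `|m| <= 1 by rewrite -x1 xE (linf_norm_ge h).
have xE' : x = val n + val m by rewrite addrC.
have n0 : 0 <= (f (val n) : K).
  exact: (support_fst_ge0 (linf_direct_sumC h) x1 xE').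
have fmn : (f (val m) : K) + f (val n) = 1.
  by have /(support_setP _ _ x1)[<- _] := xf; rewrite xE linearD.
have ball (w : submodule M) : `|w| <= 1 -> `|f (val w) : K| <= f (val m) :> K.
  move=> w1; have := support_norm_add h x1 xf w1 n1.
  by rewrite (ger0_norm n0) -fmn lerD2r.
have [->|u0] := eqVneq u 0; first by rewrite !linear0 !normr0 mulr0.
have : `| `|u|^-1 *: u | <= 1.
  by rewrite normrZ normfV normr_id mulVf ?normr_eq0.
move/ball; rewrite !linearZ /= normrM normfV normr_id.
by rewrite ler_pdivrMl ?normr_gt0// mulrC.
Qed.

Lemma dual_extendCE g (u : submodule M) (v : submodule N) :
  dual_extend (linf_direct_sumC h) g (val u + val v) = g v.
Proof. by rewrite addrC dual_extendE. Qed.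

Lemma dual_split (f : dual X) :
  f = dual_extend h (dual_restrict M f) +
      dual_extend (linf_direct_sumC h) (dual_restrict N f).
Proof.
apply/val_inj/funext => y; have [u [v ->]] := linf_split h y.
rewrite [RHS](_ : _ = dual_extend h (dual_restrict M f) (val u + val v) +
  dual_extend (linf_direct_sumC h) (dual_restrict N f) (val u + val v))//.
rewrite dual_extendE dual_extendCE.
exact: linearD.
Qed.

Lemma weakly_compact_extend (A : set (dual (submodule M))) :
  weakly_compact A -> weakly_compact (dual_extend h @` A).
Proof.
exact: (weakly_compact_image _ (adjoint_norm1 (linf_fst_norm1 h))).
Qed.

Lemma dual_restrict_eq0 {f} : support_set x f -> f (val m) = 0 :> K ->
  dual_restrict M f = 0.
Proof.
move=> xf fm; apply/val_inj/funext => u.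
have := support_fst_norm u xf; rewrite fm mul0r normr_le0 => /eqP.
by rewrite -dual_restrictE.
Qed.

Lemma support_restrict {f} : `|m| = 1 -> support_set x f ->
  f (val m) != 0 :> K ->
  support_set m ((f (val m) : K)^-1 *: dual_restrict M f).
Proof.
move=> m1 xf fm0; apply/support_setP => //; split; first exact: mulVf.
have fm : 0 < (f (val m) : K).
  rewrite lt0r fm0 (support_fst_ge0 h x1 xE xf)//.
  by rewrite -x1 xE (linf_snd_norm_le h).
move=> u; rewrite [X in `|X|](_ : _ = (f (val m) : K)^-1 * f (val u))//.
rewrite normrM normfV (gtr0_norm fm) ler_pdivrMl//.
exact: support_fst_norm.
Qed.

End linf_support.

(** * S_x as an image of S_m, or of S_m and S_n together with a segment *)

Lemma support_set_norm_lt1 {X : normedModType K} {M N : submodClosed X}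
    (h : linf_direct_sum M N) {x : X} {m : submodule M} {n : submodule N} :
  `|x| = 1 -> x = val m + val n -> `|m| = 1 -> `|n| < 1 ->
  support_set x = dual_extend h @` support_set m.
Proof.
move=> x1 xE m1 n1; have xE' : x = val n + val m by rewrite addrC.
have hC := linf_direct_sumC h.
apply/seteqP; split=> [f xf|_ [f mf <-]]; last first.
  exact: (support_extend h x1 xE m1 mf).
have n0 : 0 <= (f (val n) : K).
  by apply: (support_fst_ge0 hC x1 xE' xf); rewrite m1.
(* The bound on [N] taken at [n] itself: a positive f(n) could be cancelled, leaving 1 at most the
   norm of [n]. *)
have fn0 : f (val n) = 0 :> K.
  have := support_fst_norm hC x1 xE' n xf; rewrite (ger0_norm n0).
  have [//|fn0] := eqVneq (f (val n) : K) 0.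
  rewrite -[leLHS]mulr1 ler_pM2l ?lt0r ?fn0// => /le_lt_trans/(_ n1).
  by rewrite ltxx.
have fm1 : f (val m) = 1 :> K.
  by have /(support_setP _ _ x1)[<- _] := xf; rewrite xE linearD /= fn0 addr0.
exists (dual_restrict M f); last first.
  rewrite [RHS](dual_split h) (dual_restrict_eq0 hC x1 xE' xf fn0).
  by rewrite /dual_extend linear0 addr0.
have := support_restrict h x1 xE m1 xf.
by rewrite fm1 invr1 scale1r oner_eq0; exact.
Qed.

(** The weight is taken in [R], also for complex scalars, so that it ranges over the compact
    interval [0, 1]. *)
Definition dual_mix {X : normedModType K} {M N : submodClosed X}
    (h : linf_direct_sum M N)
    (p : R * (weak_topology (dual (submodule M)) *
              weak_topology (dual (submodule N)))) : weak_topology (dual X) :=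
  scalar_of_real p.1 *: dual_extend h p.2.1 +
  (1 - scalar_of_real p.1) *: dual_extend (linf_direct_sumC h) p.2.2.

(** Against each functional the mixture becomes a sum of products of continuous scalar functions, so
    joint continuity reduces to that of the field operations. *)
Lemma dual_mix_continuous {X : normedModType K} {M N : submodClosed X}
  (h : linf_direct_sum M N) : continuous (dual_mix h).
Proof.
apply: weak_continuous => f.
pose evM : weak_topology (dual (submodule M)) -> K := f \o dual_extend h.
pose evN : weak_topology (dual (submodule N)) -> K :=
  f \o dual_extend (linf_direct_sumC h).
have cM : continuous evM.
  exact: (weak_eval_continuous (adjoint (adjoint_norm1 (linf_fst_norm1 h)) f)).
have cN : continuous evN.
  exact: (weak_eval_continuous
    (adjoint (adjoint_norm1 (linf_fst_norm1 (linf_direct_sumC h))) f)).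
rewrite (_ : (fun p => _) = fun p => (scalar_of_real p.1 * evM p.2.1 +
    (1 - scalar_of_real p.1) * evN p.2.2 : K)); last first.
  by apply/funext => p; rewrite /dual_mix linearD !linearZ.
move=> p.
have cs : (scalar_of_real q.1 : K) @[q --> p] --> (scalar_of_real p.1 : K).
  by apply: continuous_comp; [exact: cvg_fst|exact: scalar_of_real_continuous].
apply: cvgD; apply: cvgM => //.
- apply: (@continuous_comp _ _ _ (fun q => q.2.1) evM p); last exact: cM.
  by apply: continuous_comp; [exact: cvg_snd|exact: cvg_fst].
- by apply: cvgB => //; exact: cvg_cst.
- apply: (@continuous_comp _ _ _ (fun q => q.2.2) evN p); last exact: cN.
  by apply: continuous_comp; [exact: cvg_snd|exact: cvg_snd].
Qed.

(* Splitting off the endpoints t = 0, 1 avoids having to know that S_m and S_n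
   are both nonempty, which would need Hahn-Banach. *)
Lemma support_set_norm1 {X : normedModType K} {M N : submodClosed X}
    (h : linf_direct_sum M N) {x : X} {m : submodule M} {n : submodule N} :
  `|x| = 1 -> x = val m + val n -> `|m| = 1 -> `|n| = 1 ->
  support_set x = dual_extend h @` support_set m `|`
    dual_extend (linf_direct_sumC h) @` support_set n `|`
    dual_mix h @` (`[0, 1] `*` (support_set m `*` support_set n)).
Proof.
move=> x1 xE m1 n1; have xE' : x = val n + val m by rewrite addrC.
pose hC := linf_direct_sumC h.
have real0 : scalar_of_real 0 = 0 :> K by case: (k).
have real1 : scalar_of_real 1 = 1 :> K by case: (k).
apply/seteqP; split=> [f xf|f [[[g mg <-]|[g ng <-]]|[[t [g g']]]]] /=.
- have fmn : (f (val m) : K) + f (val n) = 1.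
    by have /(support_setP _ _ x1)[<- _] := xf; rewrite xE linearD.
  have [fm0|fm0] := eqVneq (f (val m) : K) 0.
    left; right; exists (dual_restrict N f); last first.
      rewrite [RHS](dual_split h) (dual_restrict_eq0 h x1 xE xf fm0).
      by rewrite /dual_extend linear0 add0r.
    have := support_restrict hC x1 xE' n1 xf.
    move: fmn; rewrite fm0 add0r => ->.
    by rewrite invr1 scale1r oner_eq0; exact.
  have [fn0|fn0] := eqVneq (f (val n) : K) 0.
    left; left; exists (dual_restrict M f); last first.
      rewrite [RHS](dual_split h) (dual_restrict_eq0 hC x1 xE' xf fn0).
      by rewrite /dual_extend linear0 addr0.
    have := support_restrict h x1 xE m1 xf.
    move: fmn; rewrite fn0 addr0 => ->.
    by rewrite invr1 scale1r oner_eq0; exact.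
  right.
  have fm_ge0 : 0 <= (f (val m) : K).
    by apply: (support_fst_ge0 h x1 xE xf); rewrite n1.
  have fn_ge0 : 0 <= (f (val n) : K).
    by apply: (support_fst_ge0 hC x1 xE' xf); rewrite m1.
  (* The weight is f(m), so the other weight is 1 - f(m) = f(n); each restriction is normalized by
     its own weight. *)
  exists (real_of_scalar (f (val m) : K),
    ((f (val m) : K)^-1 *: dual_restrict M f,
     (f (val n) : K)^-1 *: dual_restrict N f)).
    split; last first.
      split; [exact: (support_restrict h x1 xE m1 xf fm0)|].
      exact: (support_restrict hC x1 xE' n1 xf fn0).
    rewrite /= in_itv /= -!(@ler_scalar_of_real _ k) scalar_of_realK//.
    by rewrite real0 real1 fm_ge0 -fmn lerDl.
  rewrite /dual_mix /= scalar_of_realK// -fmn addrAC subrr add0r.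
  rewrite /dual_extend !linearZ /= !scalerA !mulVf// !scale1r.
  exact/esym/(dual_split h).
- exact: (support_extend h x1 xE m1 mg).
- exact: (support_extend hC x1 xE' n1 ng).
move=> [t01 [mg ng]] <-.
move: t01; rewrite /= in_itv /= -!(@ler_scalar_of_real _ k) real0 real1.
rewrite /dual_mix /=; set s := scalar_of_real t => /andP[s0 s1].
(* Both extensions lie in S_x, and a convex combination keeps the value 1 at [x] and the pointwise
   bound. *)
have /(support_setP _ _ x1)[gx g1] := support_extend h x1 xE m1 mg.
have /(support_setP _ _ x1)[g'x g'1] := support_extend hC x1 xE' n1 ng.
have mixE y : (s *: dual_extend h g +
    (1 - s) *: dual_extend (linf_direct_sumC h) g') y =
  s * dual_extend h g y + (1 - s) * dual_extend (linf_direct_sumC h) g' y by [].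
apply/support_setP => //; split=> [|y]; rewrite mixE.
  by rewrite gx g'x !mulr1 addrC subrK.
rewrite (le_trans (ler_normD _ _))// !normrM (ger0_norm s0).
rewrite [X in _ + X * _]ger0_norm ?subr_ge0//.
have -> : `|y| = s * `|y| + (1 - s) * `|y|.
  by rewrite -mulrDl [s + _]addrC subrK mul1r.
by rewrite lerD// ler_wpM2l// subr_ge0.
Qed.

End support.

(** * Transfer of weak compactness through these descriptions of S_x *)

Theorem theorem3p1 (R : realType) (k : scalar_kind)
    (X : completeNormedModType (scalars R k)) (M N : submodClosed X)
    (x : X) (m : submodule M) (n : submodule N) :
  linf_direct_sum M N -> sphere x -> x = val m + val n ->
  (`|n| < 1 ->
     (weakly_compact (support_set x) <-> weakly_compact (support_set m))) /\
  (`|n| = 1 -> `|m| = 1 ->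
     (weakly_compact (support_set x) <->
      weakly_compact (support_set m) /\ weakly_compact (support_set n))).
Proof.
move=> h x1 xE; have xE' : x = val n + val m by rewrite addrC.
have hC := linf_direct_sumC h.
split=> [n1|n1 m1].
  (* The maximum of the two norms is 1 and is not attained by [n]. *)
  have m1 : `|m| = 1.
    have [_ _ _ _ hN] := h; have := x1; rewrite /sphere /= xE.
    rewrite hN; [|exact: valP..]; rewrite /Num.max; case: ifP => // _ n1'.
    by move: n1; rewrite [`|n|]n1' ltxx.
  split; first exact: (support_fst_compact h x1 xE m1).
  rewrite (support_set_norm_lt1 h x1 xE m1 n1); exact: weakly_compact_extend.
split=> [cx|[cm cn]].
  split; first exact: (support_fst_compact h x1 xE m1).
  exact: (support_fst_compact hC x1 xE' n1).
rewrite (support_set_norm1 h x1 xE m1 n1); apply: compactU; first apply: compactU.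
- exact: weakly_compact_extend.
- exact: weakly_compact_extend.
(* The last piece of the union is the continuous image of the compact product of [0, 1], S_m and
   S_n. *)
apply: (@continuous_compact _ (weak_topology (dual X)) (dual_mix h)).
  by apply: continuous_subspaceT; exact: dual_mix_continuous.
apply: compact_setX; first exact: segment_compact.
exact: compact_setX.
Qed.
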